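(* Let $n$ be an odd number and let $T\in\mathcal{BC}^{0,1}(V_n)$. Then for $p,s\in\rho_F(T)$ with $p\notin[s]$ the following equation holds: $$\begin{aligned}F_n^R(s,T)F_n^L(p,T)=\Big[&\Big(F_n^R(s,T)\gamma_n\mathcal{Q}_p(T)^{\frac{n-1}{2}}-\gamma_n\mathcal{Q}_s(T)^{\frac{n-1}{2}}F_n^L(p,T)\Big)p\\&-\bar s\Big(F_n^R(s,T)\gamma_n\mathcal{Q}_p(T)^{\frac{n-1}{2}}-\gamma_n\mathcal{Q}_s(T)^{\frac{n-1}{2}}F_n^L(p,T)\Big)\Big](p^2-2s_0p+|s|^2)^{-1}.\end{aligned}$$
   Context: $\mathbb{R}_n$ is the real Clifford algebra generated by $e_1,\dots,e_n$ with $e_ie_j+e_je_i=-2\delta_{ij}$; $(s_0,\dots,s_n)\in\mathbb{R}^{n+1}$ is identified with the paravector $s=s_0+\underline{s}$, $\underline{s}=\sum_{j=1}^ns_je_j$; $\bar s=s_0-\underline{s}$, $|s|^2=\sum_{j=0}^ns_j^2$; $[s]=\{s_0+I|\underline{s}|: I\in\mathbb{S}\}$ with $\mathbb{S}=\{\sum_{j=1}^n e_jx_j:\sum_jx_j^2=1\}$. $V$ is a real Banach space, $V_n=V\otimes\mathbb{R}_n$ with elements $v=\sum_Av_Ae_A$. $\mathcal{B}(V_n)$ is the set of operators $T=\sum_AT_Ae_A$, $T_A$ bounded $\mathbb{R}$-linear on $V$, acting by $T(v)=\sum_{A,B}T_A(v_B)e_Ae_B$. $\mathcal{BC}^{0,1}(V_n)$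 is the set of $T=T_0+\sum_{j=1}^ne_jT_j$ with $T_0,\dots,T_n$ bounded on $V$ and mutually commuting; $\overline{T}=T_0-\sum_{j=1}^ne_jT_j$. Elements of $\mathbb{R}_n$ are regarded as operators on $V_n$ by left multiplication, products are products of operators, $\mathcal{I}$ is the identity. $\sigma_F(T)=\{s\in\mathbb{R}^{n+1}: s^2\mathcal{I}-s(T+\overline T)+T\overline T\text{ is not invertible}\}$, $\rho_F(T)=\mathbb{R}^{n+1}\setminus\sigma_F(T)$. For $s\in\rho_F(T)$: $\mathcal{Q}_s(T)=(s^2\mathcal{I}-s(T+\overline T)+T\overline T)^{-1}$, $F_n^L(s,T)=\gamma_n(s\mathcal{I}-\overline T)\mathcal{Q}_s(T)^{\frac{n+1}{2}}$, $F_n^R(s,T)=\gamma_n\mathcal{Q}_s(T)^{\frac{n+1}{2}}(s\mathcal{I}-\overline T)$, where $\gamma_n=(-1)^{(n-1)/2}2^{n-1}\left[\left(\frac{n-1}{2}\right)!\right]^2$. *)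

(* Defs.v *)
From HB Require Import structures.
From mathcomp Require Import all_boot all_order all_algebra.
From mathcomp Require Import all_classical all_reals all_analysis.
From mathcomp Require Import ring.
Import Order.TTheory GRing.Theory Num.Theory.
Import numFieldNormedType.Exports.

Set Implicit Arguments.
Unset Strict Implicit.
Unset Printing Implicit Defensive.

Local Open Scope classical_set_scope.
Local Open Scope ring_scope.

Section RingInverse.
Variable A : pzRingType.
Implicit Types x y : A.

Definition is_inverse x y : Prop := x * y = 1 /\ y * x = 1.
Definition invertible x : Prop := exists y, is_inverse x y.
(* 0 when [x] is not invertible *)
Definition rinv x : A := xget 0 [set y | is_inverse x y].

Lemma is_inverse_rinv x : invertible x -> is_inverse x (rinv x).
Proof. by move=> [y xy]; rewrite /rinv; case: xgetP => [z _ //|/(_ y)]. Qed.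

Lemma rinvE x y : is_inverse x y -> rinv x = y.
Proof.
move=> [xy yx]; have [_ zx] : is_inverse x (rinv x) by apply: is_inverse_rinv; exists y.
by rewrite -[LHS]mulr1 -xy mulrA zx mul1r.
Qed.
End RingInverse.

(* The Clifford algebra with e_i e_j + e_j e_i = -2 delta_ij, in the basis
   e_A, A a subset of {1, ..., n}, where e_A is the product of the e_i, i in A,
   taken in increasing order (gen_anticomm, blade_prod).  Thus
   e_A e_B = +/- e_(A symdiff B); the sign counts the pairs (i, j) of A x B with
   i > j, which have to be swapped, and those with i = j, as e_i ^ 2 = -1. *)
Definition symdiff (T : finType) (A B : {set T}) : {set T} :=
  (A :\: B) :|: (B :\: A).

Definition inversions (n : nat) (A B : {set 'I_n}) : {set 'I_n * 'I_n} :=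
  [set u in finset.setX A B | (u.2 <= u.1)%N].

Definition blade_sign (R : pzRingType) (n : nat) (A B : {set 'I_n}) : R :=
  (-1) ^+ #|inversions A B|.

Definition clifford (R : comNzRingType) (n : nat) : Type :=
  {ffun {set 'I_n} -> R^o}.

Section Clifford.
Variables (R : comNzRingType) (n : nat).
Local Notation Rn := (clifford R n).
Implicit Types (A B C : {set 'I_n}) (a b c : Rn).

HB.instance Definition _ := GRing.Lmodule.copy Rn {ffun {set 'I_n} -> R^o}.

Definition coef a A : R := (a : {ffun {set 'I_n} -> R^o}) A.

Definition blade A : Rn := [ffun B => (B == A)%:R].

Definition clifford_mul a b : Rn :=
  \sum_A \sum_B (coef a A * coef b B * blade_sign R A B) *: blade (symdiff A B).

Lemma cliffordP a b : (forall A, coef a A = coef b A) -> a = b.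
Proof. by move=> h; apply/ffunP. Qed.

Lemma coefD a b A : coef (a + b) A = coef a A + coef b A.
Proof. by rewrite /coef ffunE. Qed.

Lemma coefZ k a A : coef (k *: a) A = k * coef a A.
Proof. by rewrite /coef ffunE. Qed.

Lemma coef_blade A B : coef (blade A) B = (B == A)%:R.
Proof. by rewrite /coef ffunE. Qed.

Lemma coef_sum (I : Type) (r : seq I) (P : pred I) (F : I -> Rn) A :
  coef (\sum_(i <- r | P i) F i) A = \sum_(i <- r | P i) coef (F i) A.
Proof.
elim/big_rec2: _ => [|i x y _ <-]; first by rewrite /coef ffunE.
by rewrite coefD.
Qed.

Lemma clifford_blade a : a = \sum_A coef a A *: blade A.
Proof.
apply: cliffordP => B; rewrite coef_sum (bigD1 B) //= coefZ coef_blade eqxx.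
rewrite mulr1 big1 ?addr0 // => A AB.
by rewrite coefZ coef_blade eq_sym (negbTE AB) mulr0.
Qed.

Lemma in_symdiff (T : finType) (X Y : {set T}) x :
  (x \in symdiff X Y) = (x \in X) (+) (x \in Y).
Proof. by rewrite !inE; do 2!case: (_ \in _). Qed.

Lemma symdiffA (T : finType) : associative (@symdiff T).
Proof. by move=> X Y Z; apply/setP => x; rewrite !in_symdiff addbA. Qed.

Lemma symdiff0 (T : finType) (X : {set T}) : symdiff X finset.set0 = X.
Proof. by apply/setP => x; rewrite in_symdiff inE addbF. Qed.

Lemma sym0diff (T : finType) (X : {set T}) : symdiff finset.set0 X = X.
Proof. by apply/setP => x; rewrite in_symdiff inE. Qed.

Lemma sign_symdiff (T : finType) (X Y : {set T}) :
  (-1) ^+ #|symdiff X Y| = (-1) ^+ #|X| * (-1) ^+ #|Y| :> R.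
Proof.
have h (Z : {set T}) : (-1) ^+ #|Z| = \prod_x (-1) ^+ (x \in Z) :> R.
  rewrite (bigID (mem Z)) /= [X in _ * X]big1 ?mulr1; last first.
    by move=> i /negbTE ->.
  rewrite (eq_bigr (fun=> -1)); last by move=> i ->.
  by rewrite prodr_const.
rewrite !h -big_split /=; apply: eq_bigr => x _.
by rewrite in_symdiff -signr_addb.
Qed.

Lemma blade_signDl A B C :
  blade_sign R (symdiff A B) C = blade_sign R A C * blade_sign R B C.
Proof.
rewrite /blade_sign -sign_symdiff; congr (_ ^+ #|pred_of_set _|).
apply/setP => -[i j]; rewrite in_symdiff !inE /=.
by do 3!case: (_ \in _); case: (_ <= _)%N.
Qed.

Lemma blade_signDr A B C :
  blade_sign R A (symdiff B C) = blade_sign R A B * blade_sign R A C.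
Proof.
rewrite /blade_sign -sign_symdiff; congr (_ ^+ #|pred_of_set _|).
apply/setP => -[i j]; rewrite in_symdiff !inE /=.
by do 3!case: (_ \in _); case: (_ <= _)%N.
Qed.

Lemma blade_sign0l A : blade_sign R finset.set0 A = 1.
Proof.
rewrite /blade_sign (_ : inversions _ _ = finset.set0) ?cards0 //.
by apply/setP => -[i j]; rewrite !inE.
Qed.

Lemma blade_sign0r A : blade_sign R A finset.set0 = 1.
Proof.
rewrite /blade_sign (_ : inversions _ _ = finset.set0) ?cards0 //.
by apply/setP => -[i j]; rewrite !inE andbF.
Qed.

Lemma clifford_mulDl : left_distributive clifford_mul +%R.
Proof.
move=> a b c; rewrite /clifford_mul -big_split; apply: eq_bigr => A _ /=.
rewrite -big_split; apply: eq_bigr => B _ /=.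
by rewrite coefD !mulrDl scalerDl.
Qed.

Lemma clifford_mulDr : right_distributive clifford_mul +%R.
Proof.
move=> a b c; rewrite /clifford_mul -big_split; apply: eq_bigr => A _ /=.
rewrite -big_split; apply: eq_bigr => B _ /=.
by rewrite coefD !mulrDr mulrDl scalerDl.
Qed.

Lemma clifford_mulZl k a b : k *: clifford_mul a b = clifford_mul (k *: a) b.
Proof.
rewrite scaler_sumr; apply: eq_bigr => A _; rewrite scaler_sumr.
by apply: eq_bigr => B _; rewrite scalerA coefZ !mulrA.
Qed.

Lemma clifford_mulZr k a b : k *: clifford_mul a b = clifford_mul a (k *: b).
Proof.
rewrite scaler_sumr; apply: eq_bigr => A _; rewrite scaler_sumr.
by apply: eq_bigr => B _; rewrite scalerA coefZ; congr (_ *: _); ring.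
Qed.

Lemma clifford_mul0l b : clifford_mul 0 b = 0.
Proof. by rewrite -[0 in LHS](scale0r 0) -clifford_mulZl scale0r. Qed.

Lemma clifford_mul0r b : clifford_mul b 0 = 0.
Proof. by rewrite -[0 in LHS](scale0r 0) -clifford_mulZr scale0r. Qed.

Lemma clifford_mul_suml (I : finType) (F : I -> Rn) b :
  clifford_mul (\sum_i F i) b = \sum_i clifford_mul (F i) b.
Proof.
elim/big_rec2: _ => [|i x y _ <-]; first exact: clifford_mul0l.
exact: clifford_mulDl.
Qed.

Lemma clifford_mul_sumr (I : finType) (F : I -> Rn) b :
  clifford_mul b (\sum_i F i) = \sum_i clifford_mul b (F i).
Proof.
elim/big_rec2: _ => [|i x y _ <-]; first exact: clifford_mul0r.
exact: clifford_mulDr.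
Qed.

Lemma clifford_mul_blade A B :
  clifford_mul (blade A) (blade B) = blade_sign R A B *: blade (symdiff A B).
Proof.
rewrite /clifford_mul (bigD1 A) //= (bigD1 B) //= !coef_blade !eqxx !mul1r.
rewrite big1 ?addr0 => [|C CB]; last first.
  by rewrite !coef_blade (negbTE CB) mulr0 mul0r scale0r.
rewrite big1 ?addr0 // => C CA; rewrite big1 // => D _.
by rewrite !coef_blade (negbTE CA) !mul0r scale0r.
Qed.

Lemma clifford_mulA : associative clifford_mul.
Proof.
move=> a b c.
rewrite (clifford_blade a) [clifford_mul (\sum_A _) b]clifford_mul_suml.
rewrite !clifford_mul_suml; apply: eq_bigr => A _.
rewrite -!clifford_mulZl; congr (_ *: _).
rewrite (clifford_blade b) [clifford_mul (\sum_A _) c]clifford_mul_suml.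
rewrite [clifford_mul _ (\sum_A _ *: _)]clifford_mul_sumr.
rewrite clifford_mul_sumr clifford_mul_suml; apply: eq_bigr => B _.
rewrite -clifford_mulZl -!clifford_mulZr -clifford_mulZl; congr (_ *: _).
rewrite (clifford_blade c) [clifford_mul (blade B) _]clifford_mul_sumr.
rewrite !clifford_mul_sumr; apply: eq_bigr => C _.
rewrite -!clifford_mulZr; congr (_ *: _).
rewrite !clifford_mul_blade -clifford_mulZl -clifford_mulZr.
rewrite !clifford_mul_blade !scalerA symdiffA; congr (_ *: _).
by rewrite blade_signDl blade_signDr; ring.
Qed.

Lemma clifford_mul1l : left_id (blade finset.set0) clifford_mul.
Proof.
move=> a; rewrite (clifford_blade a) clifford_mul_sumr; apply: eq_bigr => A _.
by rewrite -clifford_mulZr clifford_mul_blade blade_sign0l sym0diff scale1r.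
Qed.

Lemma clifford_mul1r : right_id (blade finset.set0) clifford_mul.
Proof.
move=> a; rewrite (clifford_blade a) clifford_mul_suml; apply: eq_bigr => A _.
by rewrite -clifford_mulZl clifford_mul_blade blade_sign0r symdiff0 scale1r.
Qed.

Lemma clifford_oner_neq0 : blade finset.set0 != 0.
Proof.
apply/eqP => /(congr1 (coef^~ finset.set0)); rewrite coef_blade eqxx.
by rewrite /coef ffunE => /eqP; rewrite oner_eq0.
Qed.

HB.instance Definition _ := GRing.Zmodule_isNzRing.Build Rn
  clifford_mulA clifford_mul1l clifford_mul1r clifford_mulDl clifford_mulDr
  clifford_oner_neq0.
HB.instance Definition _ :=
  GRing.Lmodule_isLalgebra.Build R Rn clifford_mulZl.
HB.instance Definition _ :=
  GRing.Lalgebra_isAlgebra.Build R Rn clifford_mulZr.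

Lemma blade0 : blade finset.set0 = 1. Proof. by []. Qed.

Lemma bladeM A B : blade A * blade B = blade_sign R A B *: blade (symdiff A B).
Proof. exact: clifford_mul_blade. Qed.

Definition gen (i : 'I_n) : Rn := blade [set i]%SET.

Lemma gen_anticomm i j :
  gen i * gen j + gen j * gen i = (- (2 * (i == j)%:R)) *: 1.
Proof.
rewrite !bladeM /blade_sign.
have h (k l : 'I_n) : #|inversions [set k] [set l]| = (l <= k)%N :> nat.
  case: leqP => kl; last first.
    apply/eqP; rewrite cards_eq0; apply/eqP/setP => -[x y]; rewrite !inE /=.
    by apply/negP => /andP[/andP[/eqP-> /eqP->]]; rewrite leqNgt kl.
  apply/eqP/cards1P; exists (k, l); apply/setP => -[x y].
  rewrite !inE /= xpair_eqE; case: eqP => // ->; case: eqP => // ->.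
  by rewrite kl.
have c : symdiff [set j]%SET [set i]%SET = symdiff [set i]%SET [set j]%SET.
  by apply/setP => x; rewrite !in_symdiff addbC.
rewrite !h c -scalerDl; case: (eqVneq i j) => [<-|ij] /=.
  rewrite leqnn mulr1 (_ : symdiff _ _ = finset.set0) //; last first.
    by apply/setP => x; rewrite in_symdiff addbb inE.
  by rewrite !expr1 -opprD.
have := ij; rewrite neq_ltn => /orP[] k; rewrite (ltnW k).
  rewrite [(j <= i)%N]leqNgt k /=.
  by rewrite expr0 expr1 addrN mulr0 oppr0 !scale0r.
rewrite [(i <= j)%N]leqNgt k /=.
by rewrite expr0 expr1 addNr mulr0 oppr0 !scale0r.
Qed.

Lemma blade_prod_sorted (s : seq 'I_n) :
  sorted (relpre val ltn) s -> \prod_(i <- s) gen i = blade [set i in s]%SET.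
Proof.
elim: s => [_|x s IH /= xs].
  by rewrite big_nil -blade0; congr blade; apply/setP => i; rewrite !inE.
have/allP xlt : all (relpre val ltn x) s.
  by apply: order_path_min xs => u v w; apply: ltn_trans.
rewrite big_cons IH ?(path_sorted xs) // bladeM /blade_sign.
rewrite (_ : inversions _ _ = finset.set0) ?cards0 ?expr0 ?scale1r; last first.
  apply/setP => -[u v]; rewrite !inE /=; apply/negP => /andP[/andP[/eqP ->]].
  by move=> /xlt /=; rewrite ltnNge => /negP.
congr blade; apply/setP => i; rewrite in_symdiff !inE.
by case: eqP => // ->; case: (boolP (x \in s)) => // /xlt /=; rewrite ltnn.
Qed.

Lemma blade_prod A : blade A = \prod_(i < n | i \in A) gen i.
Proof.
rewrite -big_filter blade_prod_sorted; last first.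
  apply: sorted_filter => [u v w|]; first exact: ltn_trans.
  by rewrite -sorted_map -[index_enum _]enumT val_enum_ord iota_ltn_sorted.
by congr blade; apply/setP => i; rewrite !inE mem_filter mem_index_enum andbT.
Qed.

End Clifford.

Section BoundedOperators.
Variables (R : realType) (V : normedModType R).

Definition bounded_linear : {pred V -> V} :=
  [pred f | `[< linear f /\ bounded_near f (nbhs (0 : V)) >]].

Record bop := Bop { bop_fun :> V -> V; bop_fun_bounded : bop_fun \in bounded_linear }.

Lemma bounded_linearP (f : V -> V) : f \in bounded_linear <->
  linear f /\ exists M, forall x, `|f x| <= M * `|x|.
Proof.
rewrite inE; split=> [[lf bf]|[lf [M bf]]].
  pose g : {linear V -> V} := HB.pack f (GRing.isLinear.Build _ _ _ _ _ lf).
  have [M _ hM] := pinfty_ex_gt0 ((linear_boundedP g).1 bf); split; first exact: lf.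
  by exists M.
split => //; apply/ex_bound; exists `|M|.
apply/nbhs_norm0P; exists 1 => //= x x1; apply: le_trans (bf x) _.
rewrite (le_trans (ler_wpM2r _ (ler_norm M))) // -[leRHS]mulr1.
by rewrite ler_wpM2l // ltW.
Qed.

Lemma bounded_linear_submod_closed : submod_closed bounded_linear.
Proof.
split=> [|a f g /bounded_linearP[lf [M bf]] /bounded_linearP[lg [N bg]]].
  apply/bounded_linearP; split => [a x y|]; first by rewrite scaler0 addr0.
  by exists 0 => x; rewrite normr0 mul0r.
apply/bounded_linearP; split=> [b x y|].
  rewrite !fctE lf lg !scalerDr !scalerA [a * b]mulrC -!addrA; congr (_ + _).
  by rewrite addrCA.
exists (`|a| * M + N) => x; rewrite !fctE (le_trans (ler_normD _ _)) // mulrDl.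
by rewrite lerD // normrZ -mulrA ler_wpM2l.
Qed.

HB.instance Definition _ :=
  GRing.isSubmodClosed.Build _ _ bounded_linear bounded_linear_submod_closed.
HB.instance Definition _ := [isSub for bop_fun].
HB.instance Definition _ := [Choice of bop by <:].
HB.instance Definition _ := [SubChoice_isSubLmodule of bop by <:].

Lemma bop_ext (f g : bop) : (forall x, f x = g x) -> f = g.
Proof. by move=> fg; apply: val_inj; apply/funext. Qed.

Lemma bop_linear (f : bop) : linear f.
Proof. by have [] := (bounded_linearP _).1 (bop_fun_bounded f). Qed.

HB.instance Definition _ (f : bop) :=
  GRing.isLinear.Build R V V _ (bop_fun f) (bop_linear f).

Lemma bop1_subproof : id \in bounded_linear.
Proof. by apply/bounded_linearP; split=> //; exists 1 => x; rewrite mul1r. Qed.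

Lemma bop_comp_subproof (f g : bop) : f \o g \in bounded_linear.
Proof.
have [_ [M bf]] := (bounded_linearP _).1 (bop_fun_bounded f).
have [_ [N bg]] := (bounded_linearP _).1 (bop_fun_bounded g).
apply/bounded_linearP; split => [a x y|]; first by rewrite /= !linearP.
exists (`|M| * N) => x; rewrite -mulrA.
rewrite (le_trans (bf _)) // (le_trans (ler_wpM2r _ (ler_norm M))) //.
by rewrite ler_wpM2l.
Qed.

Definition bop1 := Bop bop1_subproof.
Definition bop_comp f g := Bop (bop_comp_subproof f g).

Lemma bop_compA : associative bop_comp.
Proof. by move=> f g h; apply: val_inj. Qed.
Lemma bop_comp1l : left_id bop1 bop_comp.
Proof. by move=> f; apply: val_inj. Qed.
Lemma bop_comp1r : right_id bop1 bop_comp.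
Proof. by move=> f; apply: val_inj. Qed.
Lemma bop_compDl : left_distributive bop_comp +%R.
Proof. by move=> f g h; apply: val_inj. Qed.
Lemma bop_compDr : right_distributive bop_comp +%R.
Proof. by move=> f g h; apply: bop_ext => x; rewrite /= linearD. Qed.

HB.instance Definition _ := GRing.Zmodule_isPzRing.Build bop
  bop_compA bop_comp1l bop_comp1r bop_compDl bop_compDr.

Lemma bopME (f g : bop) x : (f * g) x = f (g x). Proof. by []. Qed.
Lemma bop1E x : (1 : bop) x = x. Proof. by []. Qed.
Lemma bopDE (f g : bop) x : (f + g) x = f x + g x. Proof. by []. Qed.
Lemma bopZE k (f : bop) x : (k *: f) x = k *: f x. Proof. by []. Qed.
Lemma bop0E x : (0 : bop) x = 0. Proof. by []. Qed.

Lemma bop_sumE (I : finType) (P : pred I) (F : I -> bop) x :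
  (\sum_(i | P i) F i) x = \sum_(i | P i) F i x.
Proof. by elim/big_rec2: _ => // i y f _ <-. Qed.
End BoundedOperators.

(* V_n = V (x) R_n: v stands for the sum of the v_A (x) e_A *)
Notation cliffvec V n := {ffun {set 'I_n} -> V}.

Section CliffordOperators.
Variables (R : realType) (V : normedModType R) (n : nat).
Implicit Types (A B C : {set 'I_n}) (v w : cliffvec V n) (a b : clifford R n).
Implicit Types (T S : {set 'I_n} -> bop V).

Definition tens (x : V) a : cliffvec V n := [ffun A => coef a A *: x].

Definition cliffop_fun T v : cliffvec V n :=
  \sum_A \sum_B tens (T A (v B)) (blade R A * blade R B).

Definition is_cliffop : {pred cliffvec V n -> cliffvec V n} :=
  [pred f | `[< exists T, f = cliffop_fun T >]].

Record cliffop := Cliffop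
  { cliffop_val :> cliffvec V n -> cliffvec V n; _ : cliffop_val \in is_cliffop }.

Lemma is_cliffopP f : reflect (exists T, f = cliffop_fun T) (f \in is_cliffop).
Proof. exact: asboolP. Qed.

Lemma is_cliffop_fun T : cliffop_fun T \in is_cliffop.
Proof. by apply/is_cliffopP; exists T. Qed.

Definition cliffop_of T : cliffop := Cliffop (is_cliffop_fun T).

Lemma tens_linearl a : linear (tens^~ a).
Proof.
by move=> k x y; apply/ffunP => A; rewrite !ffunE scalerDr !scalerA mulrC.
Qed.

Lemma tens_linearr x : linear (tens x).
Proof.
by move=> k a b; apply/ffunP => A; rewrite !ffunE coefD coefZ scalerDl scalerA.
Qed.

HB.instance Definition _ x :=
  GRing.isLinear.Build R _ _ _ (tens x) (tens_linearr x).

Lemma tens_suml (I : finType) (F : I -> V) a :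
  tens (\sum_i F i) a = \sum_i tens (F i) a.
Proof.
elim/big_rec2: _ => [|i x y _ <-].
  by apply/ffunP => A; rewrite !ffunE scaler0.
by rewrite -[F i in LHS]scale1r tens_linearl scale1r.
Qed.

Lemma tensZ k x a : tens (k *: x) a = tens x (k *: a).
Proof. by apply/ffunP => A; rewrite !ffunE coefZ scalerA mulrC. Qed.

Lemma cliffvecE v : v = \sum_A tens (v A) (blade R A).
Proof.
apply/ffunP => A; rewrite sum_ffunE (bigD1 A) //= ffunE coef_blade eqxx scale1r.
rewrite big1 ?addr0 // => B BA.
by rewrite ffunE coef_blade eq_sym (negbTE BA) scale0r.
Qed.

Lemma cliffop_fun_linear T : linear (cliffop_fun T).
Proof.
move=> k v w; rewrite /cliffop_fun scaler_sumr -big_split; apply: eq_bigr => A _.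
rewrite scaler_sumr -big_split; apply: eq_bigr => B _ /=.
by rewrite !ffunE linearP tens_linearl.
Qed.

HB.instance Definition _ T :=
  GRing.isLinear.Build R _ _ _ (cliffop_fun T) (cliffop_fun_linear T).

Lemma cliffop_fun_tens T x a :
  cliffop_fun T (tens x a) = \sum_A tens (T A x) (blade R A * a).
Proof.
apply: eq_bigr => A _; rewrite [a in RHS]clifford_blade mulr_sumr linear_sum.
apply: eq_bigr => B _ /=.
by rewrite ffunE linearZ /= tensZ -scalerAr.
Qed.

Lemma cliffop_fun_comp T S : cliffop_fun T \o cliffop_fun S =
  cliffop_fun (fun C => \sum_A \sum_(B | symdiff A B == C)
                 blade_sign R A B *: (T A * S B)).
Proof.
apply/funext => v /=; rewrite [cliffop_fun S v]/cliffop_fun linear_sum.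
rewrite [RHS]/cliffop_fun [RHS]exchange_big /=.
under eq_bigr do rewrite linear_sum; rewrite exchange_big /=.
apply: eq_bigr => D _.
under eq_bigr do rewrite cliffop_fun_tens; rewrite exchange_big /=.
under [RHS]eq_bigr => C _ do rewrite bop_sumE tens_suml.
rewrite [RHS]exchange_big /=; apply: eq_bigr => A _.
rewrite (partition_big (symdiff A) predT) //=; apply: eq_bigr => C _.
rewrite bop_sumE.
rewrite [RHS](_ : _ = \sum_(B | symdiff A B == C)
    tens ((blade_sign R A B *: (T A * S B)) (v D)) (blade R C * blade R D)).
  apply: eq_bigr => B /eqP <-.
  by rewrite bopZE bopME tensZ mulrA bladeM -scalerAl.
elim/big_rec2: _ => [|i x y _ <-].
  by apply/ffunP => E; rewrite !ffunE scaler0.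
by apply/ffunP => E; rewrite !ffunE scalerDr.
Qed.

Lemma is_cliffop_submod_closed : submod_closed is_cliffop.
Proof.
split=> [|k f g /is_cliffopP[T ->] /is_cliffopP[S ->]]; apply/is_cliffopP.
  exists (fun=> 0); apply/funext => v; rewrite /cliffop_fun big1 // => A _.
  by rewrite big1 // => B _; apply/ffunP => C; rewrite !ffunE scaler0.
exists (fun A => k *: T A + S A); apply/funext => v; rewrite !fctE /cliffop_fun.
rewrite scaler_sumr -big_split; apply: eq_bigr => A _.
rewrite scaler_sumr -big_split; apply: eq_bigr => B _ /=.
by rewrite -tens_linearl.
Qed.

HB.instance Definition _ :=
  GRing.isSubmodClosed.Build _ _ is_cliffop is_cliffop_submod_closed.
HB.instance Definition _ := [isSub for cliffop_val].
HB.instance Definition _ := [Choice of cliffop by <:].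
HB.instance Definition _ := [SubChoice_isSubLmodule of cliffop by <:].

Lemma cliffop_ext (f g : cliffop) : (forall v, f v = g v) -> f = g.
Proof. by move=> fg; apply: val_inj; apply/funext. Qed.

Lemma cliffop_linear (f : cliffop) : linear f.
Proof. by case: f => f /= /is_cliffopP[T ->]; apply: cliffop_fun_linear. Qed.

HB.instance Definition _ (f : cliffop) :=
  GRing.isLinear.Build R _ _ _ (cliffop_val f) (cliffop_linear f).

Lemma cliffop1_subproof : id \in is_cliffop.
Proof.
apply/is_cliffopP; exists (fun A => if A == finset.set0 then 1 else 0 : bop V).
apply/funext => v; rewrite /cliffop_fun (bigD1 finset.set0) //= [X in _ + X]big1.
  rewrite addr0 [LHS]cliffvecE; apply: eq_bigr => A _.
  by rewrite eqxx blade0 mul1r.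
move=> A /negbTE A0; apply: big1 => B _.
by rewrite A0; apply/ffunP => C; rewrite !ffunE scaler0.
Qed.

Lemma cliffop_comp_subproof (f g : cliffop) : f \o g \in is_cliffop.
Proof.
case: f => f /= /is_cliffopP[T ->]; case: g => g /= /is_cliffopP[S ->].
by rewrite cliffop_fun_comp is_cliffop_fun.
Qed.

Definition cliffop1 := Cliffop cliffop1_subproof.
Definition cliffop_comp f g := Cliffop (cliffop_comp_subproof f g).

Lemma cliffop_compA : associative cliffop_comp.
Proof. by move=> f g h; apply: val_inj. Qed.
Lemma cliffop_comp1l : left_id cliffop1 cliffop_comp.
Proof. by move=> f; apply: val_inj. Qed.
Lemma cliffop_comp1r : right_id cliffop1 cliffop_comp.
Proof. by move=> f; apply: val_inj. Qed.
Lemma cliffop_compDl : left_distributive cliffop_comp +%R.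
Proof. by move=> f g h; apply: val_inj. Qed.
Lemma cliffop_compDr : right_distributive cliffop_comp +%R.
Proof. by move=> f g h; apply: cliffop_ext => x; rewrite /= linearD. Qed.

HB.instance Definition _ := GRing.Zmodule_isPzRing.Build cliffop
  cliffop_compA cliffop_comp1l cliffop_comp1r cliffop_compDl cliffop_compDr.

Lemma cliffopME (f g : cliffop) v : (f * g) v = f (g v). Proof. by []. Qed.
Lemma cliffop1E v : (1 : cliffop) v = v. Proof. by []. Qed.
Lemma cliffopDE (f g : cliffop) v : (f + g) v = f v + g v. Proof. by []. Qed.
Lemma cliffopNE (f : cliffop) v : (- f) v = - f v. Proof. by []. Qed.
Lemma cliffopZE k (f : cliffop) v : (k *: f) v = k *: f v. Proof. by []. Qed.
Lemma cliffop0E v : (0 : cliffop) v = 0. Proof. by []. Qed.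

(* left multiplication by an element of R_n *)
Definition lmul a : cliffop := cliffop_of (fun A => coef a A *: (1 : bop V)).

Lemma lmul_tens a x b : lmul a (tens x b) = tens x (a * b).
Proof.
rewrite [LHS]cliffop_fun_tens [a in RHS]clifford_blade mulr_suml linear_sum.
by apply: eq_bigr => A _ /=; rewrite -scalerAl -tensZ.
Qed.

(* a bounded operator f on V, seen as the operator f e_emptyset on V_n *)
Definition cliffop_scalar (f : bop V) : cliffop :=
  cliffop_of (fun A => if A == finset.set0 then f else 0).

Lemma cliffop_scalarE f v : cliffop_scalar f v = [ffun A => f (v A)].
Proof.
rewrite [v in LHS]cliffvecE linear_sum [RHS]cliffvecE.
apply: eq_bigr => B _ /=; rewrite cliffop_fun_tens (bigD1 finset.set0) //=.
rewrite eqxx blade0 mul1r ffunE big1 ?addr0 // => A /negbTE ->.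
by apply/ffunP => C; rewrite !ffunE scaler0.
Qed.

Record BC01 := MkBC01 {
  bc_comp : 'I_n.+1 -> bop V;
  bc_commute : forall i j, bc_comp i * bc_comp j = bc_comp j * bc_comp i }.

Definition bc_vec (T : BC01) : cliffop :=
  \sum_(j < n) lmul (gen R j) * cliffop_scalar (bc_comp T (lift ord0 j)).
Definition bc_op (T : BC01) : cliffop :=
  cliffop_scalar (bc_comp T ord0) + bc_vec T.
Definition bc_conj (T : BC01) : cliffop :=
  cliffop_scalar (bc_comp T ord0) - bc_vec T.
End CliffordOperators.

Section Paravectors.
Variables (R : realType) (n : nat).
Implicit Types p s : 'rV[R]_n.+1.

Definition unit_sphere : set (clifford R n) :=
  [set I | exists x : 'rV[R]_n,
     \sum_(j < n) x 0 j ^+ 2 = 1 /\ I = \sum_(j < n) x 0 j *: gen R j].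

Definition pvec s : clifford R n := \sum_(j < n) s 0 (lift ord0 j) *: gen R j.
Definition para s : clifford R n := (s 0 ord0)%:A + pvec s.
Definition para_conj s : clifford R n := (s 0 ord0)%:A - pvec s.
Definition para_sqnorm s : R := \sum_(j < n.+1) s 0 j ^+ 2.
Definition pvec_norm s : R := Num.sqrt (\sum_(j < n) s 0 (lift ord0 j) ^+ 2).

Definition sphere_of s : set 'rV[R]_n.+1 :=
  [set p | exists2 I, unit_sphere I & para p = (s 0 ord0)%:A + pvec_norm s *: I].
End Paravectors.

Section FunctionalCalculus.
Variables (R : realType) (V : normedModType R) (n : nat).
Implicit Types (s : 'rV[R]_n.+1) (T : BC01 V n).

Definition Fpoly s T : cliffop V n :=
  lmul V (para s ^+ 2) - lmul V (para s) * (bc_op T + bc_conj T)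
  + bc_op T * bc_conj T.

Definition sigmaF T : set 'rV[R]_n.+1 := [set s | ~ invertible (Fpoly s T)].
Definition rhoF T : set 'rV[R]_n.+1 := ~` sigmaF T.

Definition Qres s T : cliffop V n := rinv (Fpoly s T).

(* used for n odd, where the halvings are exact *)
Definition gammaF : R :=
  (-1) ^+ (n.-1)./2 * 2 ^+ n.-1 * ((n.-1)./2)`!%:R ^+ 2.

Definition FL s T : cliffop V n :=
  gammaF *: ((lmul V (para s) - bc_conj T) * Qres s T ^+ (n.+1)./2).
Definition FR s T : cliffop V n :=
  gammaF *: (Qres s T ^+ (n.+1)./2 * (lmul V (para s) - bc_conj T)).
End FunctionalCalculus.
Arguments gammaF : clear implicits.

(* Main.v *)
Require Import Defs.
From mathcomp Require Import all_boot all_order all_algebra.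
From mathcomp Require Import all_classical all_reals all_analysis.
From mathcomp Require Import lra.
Import Order.TTheory GRing.Theory Num.Theory.
Import numFieldNormedType.Exports.
Local Open Scope ring_scope.

Set Implicit Arguments.
Unset Strict Implicit.

(** Write [t] for the conjugate of [T], and [W = (s - t) (p - t)].  Since [T]
and [t] commute and their sum commutes with paravectors, the polynomials
[P_x = x^2 - x (T + t) + T t] factor in the two ways
  [P_p = (p - t) p - T (p - t)]  and  [P_s = s (s - t) - (s - t) T].
In [(s - t) P_p - P_s (p - t)] the two occurrences of [T] then cancel, leaving
[W p - s W] ([quad_kernel]).

Let [M] be the product of the right and the left F-resolvents.  Up to the
constant [gamma_n^2], [M] is [W] between powers of [Q_s] and [Q_p].  As [Q_s]
commutes with [s] and [Q_p] with [p], multiplying the identity above by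
[Q_s^((n+1)/2)] on the left and by [Q_p^((n+1)/2)] on the right turns it into
  [F^R gamma Q_p^((n-1)/2) - gamma Q_s^((n-1)/2) F^L = M p - s M]
([FR_FL_bracket]).  Now apply [X |-> X p - conj(s) X] to [M p - s M].  Since
[s + conj(s)] and [conj(s) s] are real, hence central, the composite of the two
operations is multiplication of [M] on the right by [p^2 - 2 s_0 p + |s|^2]
([sylvester2]).  Off the sphere [[s]] this paravector is invertible
([sphere_poly_invertible]), which gives the theorem.

Two computations with the [e_j] enter.  [T t] is the sum of the squares of the
components of [T], so that [Q_s] commutes with [s]; and [conj(s) s = |s|^2].
Both come from squaring a sum [\sum_j e_j c_j], where the [c_j] commute with
each other and with the [e_j], and the mixed terms cancel because distinct
[e_j] anticommute ([anticomm_sum_sqr]). *)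

(** * Identities in noncommutative rings *)

Section RingIdentities.
Variable A : pzRingType.
Implicit Types p s t u W P Q x y : A.

Lemma quad_sylvesterl p u t : GRing.comm p (u + t) ->
  p ^+ 2 - p * (u + t) + u * t = (p - t) * p - u * (p - t).
Proof.
move=> ->; rewrite mulrDl mulrBl mulrBr expr2 !opprD !opprK.
by rewrite -!addrA; congr (_ + _); rewrite addrCA.
Qed.

Lemma quad_sylvesterr s u t : GRing.comm u t ->
  s ^+ 2 - s * (u + t) + u * t = s * (s - t) - (s - t) * u.
Proof.
move=> ut; rewrite ut mulrDr mulrBl mulrBr expr2 opprD opprB.
by rewrite -!addrA; congr (_ + _); rewrite addrCA; congr (_ + _); rewrite addrC.
Qed.

(** Both factorizations produce the product [(s - t) u (p - t)], with opposite
signs in the difference. *)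
Lemma quad_kernel p s u t :
    GRing.comm p (u + t) -> GRing.comm u t ->
  (s - t) * (p ^+ 2 - p * (u + t) + u * t)
    - (s ^+ 2 - s * (u + t) + u * t) * (p - t)
  = (s - t) * (p - t) * p - s * ((s - t) * (p - t)).
Proof.
move=> pu ut; rewrite (quad_sylvesterl pu) (quad_sylvesterr s ut).
by move: (s - t) (p - t) => x y; rewrite mulrBr mulrBl !mulrA opprB addrA subrK.
Qed.

(** The operators [X |-> X p - s X] and [X |-> X p - s' X] compose like the
factors of the polynomial with roots [s] and [s'] evaluated at [p], the
coefficients [s + s'] and [s' s] being moved across [W]. *)
Lemma sylvester2 (s' : A) s p W :
    GRing.comm W (s + s') -> GRing.comm W (s' * s) ->
  (W * p - s * W) * p - s' * (W * p - s * W)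
  = W * (p ^+ 2 - (s + s') * p + s' * s).
Proof.
move=> W1 W2; rewrite [RHS]mulrDr [X in _ = X + _]mulrBr W2 [W * (_ * p)]mulrA W1.
rewrite expr2 mulrBl mulrBr !mulrDl !mulrA opprB opprD.
by rewrite -!addrA; do 2!congr (_ + _); rewrite addrC.
Qed.

Lemma is_inverse_comm P Q x : is_inverse P Q -> GRing.comm x P -> GRing.comm x Q.
Proof.
move=> [PQ QP] xP; rewrite /GRing.comm -[LHS]mul1r -QP -mulrA (mulrA P) -xP.
by rewrite -(mulrA x) PQ mulr1.
Qed.

(** Symmetrizing the double sum in the two indices makes the anticommutators of
the [e i] appear.  A general ring does not allow division by 2, whence the
factor on both sides. *)
Lemma anticomm_sum_sqr (n : nat) (e c : 'I_n -> A) :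
    (forall i j, e i * e j + e j * e i = - ((i == j)%:R *+ 2)) ->
    (forall i j, GRing.comm (e i) (c j)) ->
    (forall i j, GRing.comm (c i) (c j)) ->
  (\sum_j e j * c j) ^+ 2 *+ 2 = (- \sum_j c j ^+ 2) *+ 2.
Proof.
move=> ee ec cc; pose X i j := e i * e j * (c i * c j).
have sqrE : (\sum_j e j * c j) ^+ 2 = \sum_i \sum_j X i j.
  rewrite expr2 mulr_suml; apply: eq_bigr => i _; rewrite mulr_sumr.
  by apply: eq_bigr => j _; rewrite /X -!mulrA (mulrA (c i)) -ec !mulrA.
rewrite mulr2n [X in X + _]sqrE exchange_big /= sqrE -big_split -sumrN -sumrMnl /=.
apply: eq_bigr => i _; rewrite -big_split (bigD1 i) //= big1 => [|j ji].
  by rewrite addr0 /X -mulrDl ee eqxx mulNr mulNrn mulrnAl mul1r -expr2.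
by rewrite /X (cc j i) -mulrDl ee (negbTE ji) mul0rn oppr0 mul0r.
Qed.

(** [x P] and [S y] appear once [Qp ^+ m] is written [P * Qp ^+ m.+1] and
[Qs ^+ m] is written [Qs ^+ m.+1 * S]; the outer powers then let [p] and [s]
pass. *)
Lemma resolvent_bracket (m : nat) (S P Qs Qp s p x y : A) :
    is_inverse S Qs -> is_inverse P Qp -> GRing.comm s Qs -> GRing.comm p Qp ->
    x * P - S * y = x * y * p - s * (x * y) ->
  Qs ^+ m.+1 * x * Qp ^+ m - Qs ^+ m * (y * Qp ^+ m.+1)
  = Qs ^+ m.+1 * x * (y * Qp ^+ m.+1) * p
    - s * (Qs ^+ m.+1 * x * (y * Qp ^+ m.+1)).
Proof.
move=> [_ QS] [PQ _] sQ pQ xy.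
have -> : Qs ^+ m.+1 * x * Qp ^+ m = Qs ^+ m.+1 * (x * P) * Qp ^+ m.+1.
  by rewrite [Qp ^+ m.+1]exprS !mulrA -(mulrA _ P) PQ mulr1.
have -> : Qs ^+ m * (y * Qp ^+ m.+1) = Qs ^+ m.+1 * (S * y) * Qp ^+ m.+1.
  by rewrite [Qs ^+ m.+1]exprSr !mulrA -(mulrA _ Qs) QS mulr1.
rewrite -mulrBl -mulrBr xy mulrBr mulrBl !mulrA.
by rewrite (commrX m.+1 sQ) -(mulrA _ (Qp ^+ _) p) -(commrX m.+1 pQ) !mulrA.
Qed.

End RingIdentities.

(** * The ring of Clifford operators *)

Lemma gen_anticomm_natr (R : comNzRingType) (n : nat) (i j : 'I_n) :
  gen R i * gen R j + gen R j * gen R i = - ((i == j)%:R *+ 2).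
Proof.
rewrite gen_anticomm scaleNr; case: (i == j).
  by rewrite mulr1 scaler_nat.
by rewrite mulr0 scale0r mul0rn.
Qed.

Section CliffordOperatorAlgebra.
Variables (R : realType) (V : normedModType R) (n : nat).
Implicit Types (a b : clifford R n) (f g : cliffop V n) (h k : bop V).

Lemma cliffop_scalerAl c f g : c *: (f * g) = (c *: f) * g.
Proof. exact: cliffop_ext. Qed.

Lemma cliffop_scalerAr c f g : c *: (f * g) = f * (c *: g).
Proof. by apply: cliffop_ext => v; rewrite cliffopME !cliffopZE linearZ. Qed.

(** The elementary tensors span, and [lmul] and [cliffop_scalar] act on
different factors of them; this yields the algebra of [lmul] and
[cliffop_scalar] below without expansion on blades. *)
Lemma cliffop_ext_tens f g :
  (forall x a, f (tens x a) = g (tens x a)) -> f = g.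
Proof.
move=> fg; apply: cliffop_ext => v; rewrite (cliffvecE v) !linear_sum.
by apply: eq_bigr => A _; apply: fg.
Qed.

Lemma lmulM a b : lmul V (a * b) = lmul V a * lmul V b.
Proof.
by apply: cliffop_ext_tens => x c; rewrite cliffopME !lmul_tens mulrA.
Qed.

Lemma lmul_linear : linear (@lmul R V n).
Proof.
move=> c a b; apply: cliffop_ext_tens => x d.
rewrite cliffopDE cliffopZE !lmul_tens -linearP.
by rewrite mulrDl -scalerAl.
Qed.

Lemma lmul1 : lmul V 1 = 1 :> cliffop V n.
Proof. by apply: cliffop_ext_tens => x c; rewrite lmul_tens mul1r. Qed.

Lemma lmulD a b : lmul V (a + b) = lmul V a + lmul V b.
Proof. by rewrite -[a in LHS]scale1r lmul_linear scale1r. Qed.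

Lemma lmul0 : lmul V 0 = 0 :> cliffop V n.
Proof. by apply: (addrI (lmul V 0)); rewrite -lmulD !addr0. Qed.

Lemma lmulZ c a : lmul V (c *: a) = c *: lmul V a.
Proof. by rewrite -[_ *: a in LHS]addr0 lmul_linear lmul0 addr0. Qed.

Lemma lmulN a : lmul V (- a) = - lmul V a.
Proof. by rewrite -scaleN1r lmulZ scaleN1r. Qed.

Lemma lmulX2 a : lmul V (a ^+ 2) = lmul V a ^+ 2.
Proof. by rewrite !expr2 lmulM. Qed.

Lemma scalar_central c f : GRing.comm f (lmul V c%:A).
Proof.
by rewrite /GRing.comm lmulZ lmul1 -cliffop_scalerAr -cliffop_scalerAl mulr1 mul1r.
Qed.

Lemma cliffop_scalar_tens h x a :
  cliffop_scalar n h (tens x a) = tens (h x) a.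
Proof. by rewrite cliffop_scalarE; apply/ffunP => A; rewrite !ffunE linearZ. Qed.

Lemma cliffop_scalarM h k :
  cliffop_scalar n (h * k) = cliffop_scalar n h * cliffop_scalar n k.
Proof.
by apply: cliffop_ext_tens => x a; rewrite cliffopME !cliffop_scalar_tens.
Qed.

Lemma lmul_scalar_comm a h : GRing.comm (lmul V a) (cliffop_scalar n h).
Proof.
apply: cliffop_ext_tens => x b.
by rewrite !cliffopME lmul_tens !cliffop_scalar_tens lmul_tens.
Qed.

Variable T : BC01 V n.
Local Notation C j := (cliffop_scalar n (bc_comp T j)).

Lemma scalar_bc_vec_comm : GRing.comm (C ord0) (bc_vec T).
Proof.
apply: commr_sum => j _; apply: commrM.
  exact/commr_sym/lmul_scalar_comm.
by rewrite /GRing.comm -!cliffop_scalarM bc_commute.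
Qed.

(** The square has no vector part, so that it commutes with Clifford numbers
although [bc_vec T] itself need not. *)
Lemma bc_vec_sqr :
  bc_vec T ^+ 2 = - \sum_(j < n) C (lift ord0 j) ^+ 2.
Proof.
apply: (@scalerI R _ 2); first by rewrite pnatr_eq0.
rewrite !scaler_nat; apply: anticomm_sum_sqr => i j.
- rewrite -!lmulM -lmulD gen_anticomm_natr lmulN -scaler_nat lmulZ scaler_nat.
  case: (i == j); first by rewrite lmul1.
  by rewrite mulr0n lmul0.
- exact: lmul_scalar_comm.
- by rewrite /GRing.comm -!cliffop_scalarM bc_commute.
Qed.

Lemma bc_opD_conj : bc_op T + bc_conj T = C ord0 + C ord0.
Proof. by rewrite addrACA subrr addr0. Qed.

Lemma bc_op_conj_comm : GRing.comm (bc_op T) (bc_conj T).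
Proof.
apply: commrB; apply/commr_sym; apply: commrD => //.
  exact: scalar_bc_vec_comm.
exact/commr_sym/scalar_bc_vec_comm.
Qed.

Lemma bc_opM_conj : bc_op T * bc_conj T = \sum_j C j ^+ 2.
Proof.
rewrite mulrDl !mulrBr -scalar_bc_vec_comm addrA subrK -!expr2 bc_vec_sqr.
by rewrite opprK big_ord_recl.
Qed.

Lemma lmul_bc_opD_conj a : GRing.comm (lmul V a) (bc_op T + bc_conj T).
Proof. by rewrite bc_opD_conj; apply: commrD; apply: lmul_scalar_comm. Qed.

Lemma lmul_bc_opM_conj a : GRing.comm (lmul V a) (bc_op T * bc_conj T).
Proof.
rewrite bc_opM_conj; apply: commr_sum => j _; apply: commrX.
exact: lmul_scalar_comm.
Qed.

Lemma FpolyE s : Fpoly s T = lmul V (para s) ^+ 2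
  - lmul V (para s) * (bc_op T + bc_conj T) + bc_op T * bc_conj T.
Proof. by rewrite /Fpoly lmulX2. Qed.

Lemma lmul_Fpoly_comm s : GRing.comm (lmul V (para s)) (Fpoly s T).
Proof.
rewrite FpolyE; apply: commrD; last exact: lmul_bc_opM_conj.
apply: commrB; first exact: commrX.
by apply: commrM => //; apply: lmul_bc_opD_conj.
Qed.

Lemma is_inverse_Qres s : rhoF T s -> is_inverse (Fpoly s T) (Qres s T).
Proof. by move=> /contrapT; apply: is_inverse_rinv. Qed.

Lemma lmul_Qres_comm s : rhoF T s -> GRing.comm (lmul V (para s)) (Qres s T).
Proof.
by move=> /is_inverse_Qres /is_inverse_comm; apply; apply: lmul_Fpoly_comm.
Qed.

(** The bracket of the F-resolvent equation is a Sylvester difference of the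
very product that the equation computes. *)
Lemma FR_FL_bracket (n_odd : odd n) p s : rhoF T p -> rhoF T s ->
  FR s T * (gammaF R n *: Qres p T ^+ (n.-1)./2)
    - gammaF R n *: Qres s T ^+ (n.-1)./2 * FL p T
  = FR s T * FL p T * lmul V (para p) - lmul V (para s) * (FR s T * FL p T).
Proof.
move=> hp hs.
have halfE : (n.+1)./2 = ((n.-1)./2).+1 by case: (n) n_odd => // k _.
rewrite /FR /FL halfE; set m := (n.-1)./2.
rewrite -!cliffop_scalerAl -!cliffop_scalerAr -!cliffop_scalerAl -!scalerBr.
do 2!congr (_ *: _); apply: resolvent_bracket.
- exact: is_inverse_Qres.
- exact: is_inverse_Qres.
- exact: lmul_Qres_comm.
- exact: lmul_Qres_comm.
rewrite !FpolyE; apply: quad_kernel; last exact: bc_op_conj_comm.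
exact: lmul_bc_opD_conj.
Qed.

End CliffordOperatorAlgebra.

(** * Paravectors and their spheres *)

Section ParavectorAlgebra.
Variables (R : realType) (n : nat).
Implicit Types p s : 'rV[R]_n.+1.
Local Notation sqv s := (\sum_(j < n) s 0 (lift ord0 j) ^+ 2).

Lemma para_sqnormE s : para_sqnorm s = s 0 ord0 ^+ 2 + sqv s.
Proof. by rewrite /para_sqnorm big_ord_recl. Qed.

Lemma pvec_sqr s : pvec s ^+ 2 = (- sqv s)%:A.
Proof.
have -> : pvec s = \sum_j gen R j * (s 0 (lift ord0 j))%:A.
  by apply: eq_bigr => j _; rewrite mulr_algr.
have -> : (- sqv s)%:A = - \sum_j (s 0 (lift ord0 j))%:A ^+ 2 :> clifford R n.
  rewrite scaleNr scaler_suml; congr (- _); apply: eq_bigr => j _.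
  by rewrite exprZn expr1n.
apply: (@scalerI R _ 2); first by rewrite pnatr_eq0.
rewrite !scaler_nat; apply: anticomm_sum_sqr => i j.
- exact: gen_anticomm_natr.
- by rewrite /GRing.comm mulr_algl mulr_algr.
- by rewrite /GRing.comm mulr_algl mulr_algr.
Qed.

Lemma paraD_conj s : para s + para_conj s = (2 * s 0 ord0)%:A.
Proof. by rewrite addrACA subrr addr0 -scalerDl mulr_natl mulr2n. Qed.

Lemma para_conjM s : para_conj s * para s = (para_sqnorm s)%:A.
Proof.
rewrite /para_conj /para mulrBl !mulrDr -!scalerAl -!scalerAr !mul1r !mulr1.
rewrite -expr2 pvec_sqr opprD addrA addrK para_sqnormE scalerA -scaleNr opprK.
by rewrite -scalerDl expr2.
Qed.

Lemma para_sqr p : para p ^+ 2 = (2 * p 0 ord0) *: para p - (para_sqnorm p)%:A.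
Proof.
rewrite -para_conjM -[(2 * p 0 ord0) *: para p]mulr_algl -paraD_conj mulrDl.
by rewrite addrK expr2.
Qed.

Lemma para_inverse q : para_sqnorm q != 0 ->
  is_inverse (para q) ((para_sqnorm q)^-1 *: para_conj q : clifford R n).
Proof.
move=> q0; have qC : para q * para_conj q = para_conj q * para q.
  have -> : para_conj q = (2 * q 0 ord0)%:A - para q.
    by rewrite -paraD_conj addrC addKr.
  by move: (para q) => x; rewrite mulrBr mulrBl mulr_algl mulr_algr.
split; rewrite -?scalerAr -?scalerAl ?qC para_conjM scalerA mulVf //;
  exact: scale1r.
Qed.

(** The unit vector is [pvec p] normalized, or, when [pvec p] vanishes, an
arbitrary one: the first generator, which exists because [0 < n]. *)
Lemma sphere_of_eq p s : (0 < n)%N -> p 0 ord0 = s 0 ord0 -> sqv p = sqv s ->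
  sphere_of s p.
Proof.
move=> n_gt0 p0s0 pE; rewrite /sphere_of /= /para p0s0.
have sge0 : 0 <= sqv s by apply: sumr_ge0 => j _; apply: sqr_ge0.
have rr : pvec_norm s ^+ 2 = sqv s by rewrite sqr_sqrtr.
have [r0|r0] := eqVneq (pvec_norm s) 0.
  have /psumr_eq0P pj0 : sqv p = 0 by rewrite pE -rr r0 expr0n.
  exists (gen R (Ordinal n_gt0)).
    exists (delta_mx 0 (Ordinal n_gt0)); split.
      rewrite (bigD1 (Ordinal n_gt0)) //= mxE !eqxx expr1n big1 ?addr0 // => j.
      by move=> /negbTE jn; rewrite mxE jn andbF expr0n.
    rewrite (bigD1 (Ordinal n_gt0)) //= mxE !eqxx scale1r big1 ?addr0 // => j.
    by move=> /negbTE jn; rewrite mxE jn andbF scale0r.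
  congr (_ + _); rewrite r0 scale0r /pvec big1 // => j _.
  have /eqP : p 0 (lift ord0 j) ^+ 2 = 0 by apply: pj0 => // i _; apply: sqr_ge0.
  by rewrite sqrf_eq0 => /eqP ->; rewrite scale0r.
exists ((pvec_norm s)^-1 *: pvec p).
  exists (\row_j (p 0 (lift ord0 j) / pvec_norm s)); split.
    under eq_bigr do rewrite mxE expr_div_n.
    by rewrite -mulr_suml pE -rr divff // sqrf_eq0.
  rewrite /pvec scaler_sumr; apply: eq_bigr => j _.
  by rewrite mxE scalerA mulrC.
by rewrite scalerA divff // scale1r.
Qed.

(** By [para_sqr] the polynomial is [c p + d], with [c = 2 (p_0 - s_0)] and
[d = |s|^2 - |p|^2], hence a paravector; it is invertible unless it vanishes.
If it does, either [c = 0], or [pvec p = 0] and then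
[d + c p_0 = (p_0 - s_0)^2 + |pvec s|^2] forces [p_0 = s_0] as well.  So
[p_0 = s_0] and [d = 0], which puts [p] on the sphere of [s]. *)
Lemma sphere_poly_invertible p s : (0 < n)%N -> ~ sphere_of s p ->
  invertible (para p ^+ 2 - (2 * s 0 ord0) *: para p + (para_sqnorm s)%:A).
Proof.
move=> n_gt0 ps.
pose c := 2 * (p 0 ord0 - s 0 ord0); pose d := para_sqnorm s - para_sqnorm p.
(* [para q] is [c p + d], the real number [d] sitting in coordinate 0. *)
pose q := c *: p + d *: delta_mx 0 ord0.
have q0E : q 0 ord0 = c * p 0 ord0 + d by rewrite !mxE !eqxx mulr1.
have qjE j : q 0 (lift ord0 j) = c * p 0 (lift ord0 j).
  by rewrite !mxE /= mulr0 addr0.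
have -> : para p ^+ 2 - (2 * s 0 ord0) *: para p + (para_sqnorm s)%:A = para q.
  have -> : para q = c *: para p + d%:A.
    rewrite /para q0E scalerDl scalerDr scalerA addrAC; congr (_ + _ + _).
    rewrite /pvec scaler_sumr; apply: eq_bigr => j _.
    by rewrite qjE scalerA.
  rewrite para_sqr (addrAC ((2 * p 0 ord0) *: _)) /c /d mulrBr !scalerBl.
  by rewrite [RHS]addrA [RHS]addrAC.
exists ((para_sqnorm q)^-1 *: para_conj q : clifford R n); apply: para_inverse.
apply/eqP => q_eq0.
have sqv_ge0 (r : 'rV[R]_n.+1) : 0 <= sqv r.
  by apply: sumr_ge0 => j _; apply: sqr_ge0.
have sqvq : sqv q = c ^+ 2 * sqv p.
  by rewrite mulr_sumr; apply: eq_bigr => j _; rewrite qjE exprMn.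
move: q_eq0; rewrite para_sqnormE => /eqP.
rewrite paddr_eq0 ?sqr_ge0 // sqrf_eq0 q0E sqvq mulf_eq0 sqrf_eq0.
have dE : d = s 0 ord0 ^+ 2 + sqv s - (p 0 ord0 ^+ 2 + sqv p).
  by rewrite /d !para_sqnormE.
move=> /andP[/eqP cd /orP cp].
have p0s0 : p 0 ord0 = s 0 ord0.
  case: cp => /eqP; rewrite /c.
    by move=> /eqP; rewrite mulf_eq0 pnatr_eq0 subr_eq0 => /eqP.
  (* The equation [cd] reads [(p_0 - s_0)^2 + sqv s = 0]. *)
  move=> p0; have := sqv_ge0 s; move: cd; rewrite dE /c p0 => cd s0.
  apply/eqP; rewrite -subr_eq0 -sqrf_eq0; apply/eqP/le_anti.
  rewrite sqr_ge0 andbT; lra.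
apply: ps; apply: sphere_of_eq => //.
by move: cd; rewrite dE /c p0s0; lra.
Qed.
End ParavectorAlgebra.

Theorem theorem5p3 (R : realType) (V : completeNormedModType R) (n : nat)
    (n_odd : odd n) (T : BC01 V n) (p s : 'rV[R]_n.+1)
    (p_res : rhoF T p) (s_res : rhoF T s) (p_notin : ~ sphere_of s p) :
  FR s T * FL p T =
  ((FR s T * (gammaF R n *: Qres p T ^+ (n.-1)./2)
      - gammaF R n *: Qres s T ^+ (n.-1)./2 * FL p T) * lmul V (para p)
   - lmul V (para_conj s)
      * (FR s T * (gammaF R n *: Qres p T ^+ (n.-1)./2)
         - gammaF R n *: Qres s T ^+ (n.-1)./2 * FL p T))
  * lmul V (rinv (para p ^+ 2 - (2 * s 0 ord0) *: para p + (para_sqnorm s)%:A)).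
Proof.
set X := _ - _ * FL p T.
have -> : X = FR s T * FL p T * lmul V (para p)
    - lmul V (para s) * (FR s T * FL p T) by apply: FR_FL_bracket.
rewrite sylvester2 -?lmulD -?lmulM ?paraD_conj ?para_conjM;
  try exact: scalar_central.
rewrite mulr_algl -lmulX2 -lmulN -!lmulD -mulrA -lmulM.
have [-> _] := is_inverse_rinv (sphere_poly_invertible (odd_gt0 n_odd) p_notin).
by rewrite lmul1 mulr1.
Qed.
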